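(* Let $q$ be a power of a prime $p$ and let $e,k$ be nontrivial divisors of $q-1$ such that $q=ek+1$. If $$p>\left(\frac{3k}{\varphi(k)}\right)^{\frac{\varphi(k)}{2\operatorname{ord}_k(p)}},$$ then the cyclotomic number $(0,0)$ of order $e$ over $\mathbb{F}_q$ satisfies $$(0,0)=\begin{cases}0&\text{if } k\not\equiv 0\pmod 6\text{ and }2\notin C_0,\\ 1&\text{if } k\not\equiv 0\pmod 6\text{ and }2\in C_0,\\ 2&\text{if } k\equiv 0\pmod 6\text{ and }2\notin C_0,\\ 3&\text{if } k\equiv 0\pmod 6\text{ and }2\in C_0.\end{cases}$$
   Context: A nontrivial divisor of $q-1$ is a divisor different from $1$ and $q-1$. $\operatorname{ord}_k(p)$ is the multiplicative order of $p$ modulo $k$ and $\varphi$ is Euler's totient function. Fix a primitive element $g$ of the finite field $\mathbb{F}_q$. For $a\in\mathbb{Z}$ let $C_a=\{g^a,g^{a+e},\dots,g^{a+(k-1)e}\}$, so that $C_a=C_{a+e}$. The cyclotomic number $(a,b)$ of order $e$ is the number of solutions of $1+x=y$ with $x\in C_a$, $y\in C_b$; equivalently, the number of pairs of integers $(r,s)$ with $0\le r,s\le k-1$ and $1+g^{a+re}=g^{b+se}$. In ''$2\in C_0$'', $2$ denotes the element $1+1$ of $\mathbb{F}_q$. *)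

(* Defs.v *)
From HB Require Import structures.
From mathcomp Require Import all_boot all_order all_algebra all_fingroup.
From mathcomp Require Import reals exp.
Set Implicit Arguments.
Unset Strict Implicit.
Unset Printing Implicit Defensive.
Import Order.TTheory GRing.Theory Num.Theory.
Local Open Scope ring_scope.

Definition nontrivial_divisor (d n : nat) : Prop :=
  [/\ (d %| n)%N, d <> 1%N & d <> n].

(* Meaningful for 1 < k ('Z_k is the ring Z/kZ only then) and p coprime to k;
   when p is not invertible mod k, insubd falls back on the unit 1. *)
Definition ord_mod (k p : nat) : nat :=
  #[insubd (1%g : {unit 'Z_k}) (p%:R : 'Z_k)]%g.

(* a ranges over the integers, so ^ is exponentiation with an int exponent. *)
Definition cyclotomic_class (F : finFieldType) (g : F) (e k : nat) (a : int) :
    {set F} :=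
  [set g ^ (a + (i * e)%N%:Z) | i : 'I_k].

Definition cyclotomic_number (F : finFieldType) (g : F) (e k : nat)
    (a b : int) : nat :=
  #|[set xy : F * F | [&& xy.1 \in cyclotomic_class g e k a,
                          xy.2 \in cyclotomic_class g e k b
                        & 1 + xy.1 == xy.2]]|.

(* Main.v *)
Require Import Defs.
From HB Require Import structures.
From mathcomp Require Import all_boot all_order all_algebra all_fingroup.
From mathcomp Require Import all_field ring zify.
From mathcomp Require Import reals exp.
Set Implicit Arguments.
Unset Strict Implicit.
Unset Printing Implicit Defensive.
Import Order.TTheory GRing.Theory Num.Theory.
Local Open Scope ring_scope.

(** The class C_0 is the group of k-th roots of unity of F, so the number to
    compute counts the x such that both x and 1 + x are k-th roots of unity.
    The point x = 1 is such a solution exactly when 2 lies in C_0.  If 6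
    divides k, the two primitive cube roots of unity are solutions as well,
    because 1 + x = - x ^+ 2.  The bound on p serves to show that there are no
    others, and it does so by lifting a solution to characteristic zero.

    Let w be a primitive k-th root of unity in F and suppose that
    1 + w ^+ r = w ^+ s, with 0, r and s distinct modulo k.  Put
    h = 1 + X^r - X^s, and let N be the norm of h(zeta) from the cyclotomic
    ring Z[zeta] to Z, realised as the determinant of the matrix of
    multiplication by h on Z[X] / Phi_k.  Two facts about N conflict with the
    bound unless N = 0.

    - p ^ f divides N, where f is the order of p modulo k.  Over any field with
      a primitive k-th root of unity z, the matrix is diagonalised by a
      Vandermonde matrix, its eigenvalues being the h(z ^+ j) with j coprime to
      k (mulmod_Cyclotomic_diag).  Over F, Frobenius makes at least f of them
      vanish, so the matrix loses rank f modulo p, and the Smith normal form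
      turns this into divisibility of the determinant (dvdz_det_corank).

    - |N|^2 is at most (3k / phi(k)) ^ phi(k).  Indeed |N|^2 is the product of
      the phi(k) numbers |h(zeta^j)|^2, and the sum of |h(zeta^j)|^2 over all j
      modulo k is 3k by orthogonality (sum_norm_trinomial); the inequality of
      arithmetic and geometric means concludes.

    Hence N = 0, so some complex primitive k-th root z satisfies
    1 + z ^+ r = z ^+ s (trinomial_lift).  Three complex numbers of modulus 1 in
    this position form an equilateral triangle (unit_triangle): 6 divides k and
    z ^+ r is a cube root of unity.  As w and z have the same order, w ^+ r is a
    cube root of unity too. *)

(** * Rank modulo p and divisibility of determinants *)

Lemma mxrank_sum_le (K : fieldType) (m n : nat) (I : finType) (P : pred I)
    (A : I -> 'M[K]_(m, n)) :
  (\rank (\sum_(i | P i) A i)%R <= \sum_(i | P i) \rank (A i))%N.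
Proof.
elim/big_rec2: _ => [|i r B _ leBr]; first by rewrite mxrank0.
by rewrite (leq_trans (mxrank_add _ _)) // leq_add2l.
Qed.

Lemma mxrank_diag_le (K : fieldType) (n : nat) (d : 'rV[K]_n) :
  (\rank (diag_mx d) <= #|[set i | d 0%R i != 0%R]|)%N.
Proof.
have -> : diag_mx d =
    \sum_(i | i \in [set i | d 0%R i != 0%R]) d 0 i *: delta_mx i i.
  rewrite diag_mx_sum_delta [RHS]big_mkcond; apply: eq_bigr => i _.
  by rewrite inE; case: eqP => // ->; rewrite scale0r.
rewrite (leq_trans (mxrank_sum_le _ _)) // -sum1_card leq_sum // => i _.
by rewrite (leq_trans (mxrank_scale _ _)) // mxrank_delta.
Qed.

(** The lower bound comes from the upper one: completing the zeros of d by ones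
    gives an invertible diagonal matrix, and the rank is subadditive. *)
Lemma mxrank_diag (K : fieldType) (n : nat) (d : 'rV[K]_n) :
  \rank (diag_mx d) = #|[set i | d 0%R i != 0%R]|.
Proof.
apply/eqP; rewrite eqn_leq mxrank_diag_le /=.
pose c : 'rV[K]_n := \row_i (d 0 i == 0)%:R.
have rank_dc : \rank (diag_mx (d + c)) = n.
  apply/mxrank_unit; rewrite unitmxE det_diag unitfE.
  apply/prodf_neq0 => i _; rewrite !mxE.
  by have [->|] := eqVneq (d 0 i) 0; rewrite ?add0r ?oner_eq0 ?addr0.
have := mxrank_add (diag_mx d) (diag_mx c).
rewrite -linearD /= rank_dc.
move=> /leq_trans/(_ (leq_add (leqnn _) (mxrank_diag_le c))).
have -> : [set i | c 0%R i != 0] = ~: [set i | d 0%R i != 0%R].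
  apply/setP=> i; rewrite !inE mxE negbK.
  by case: (d 0 i == 0); rewrite ?oner_eq0 ?eqxx.
by rewrite -{1}(card_ord n) -(cardsC [set i | d 0%R i != 0%R]) leq_add2r.
Qed.

(** The rank of M over K is the number of elementary divisors of M that are
    prime to p, and det M is their product up to a unit. *)
Lemma dvdz_det_corank (K : fieldType) (p n : nat) (M : 'M[int]_n) :
  p \in [pchar K] ->
  ((p ^ (n - \rank (map_mx (intr : int -> K) M)))%N%:Z %| \det M)%Z.
Proof.
move=> pK; have [L uL [R uR [d _ defM]]] := int_Smith_normal_form M.
set D := (\matrix_(i, j) _)%R in defM.
have defD : D = diag_mx (\row_i d`_i).
  by apply/matrixP=> i j; rewrite !mxE mulrb; case: eqP => [->|/eqP/negPf]//;
     rewrite -val_eqE => ->.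
pose dK : 'rV[K]_n := \row_i (d`_i)%:~R.
have unitK (A : 'M[int]_n) :
    A \in unitmx -> map_mx (intr : int -> K) A \in unitmx.
  by rewrite !unitmxE det_map_mx; apply: rmorph_unit.
have -> : \rank (map_mx (intr : int -> K) M) = #|[set i | dK 0 i != 0]|.
  rewrite defM !map_mxM /= mxrankMfree ?row_free_unit ?unitK //.
  rewrite eqmxMfull ?row_full_unit ?unitK // -(mxrank_diag dK).
  congr (\rank _); apply/matrixP=> i j; rewrite defD !mxE.
  by case: eqP.
rewrite defM !det_mulmx dvdz_mulr // dvdz_mull // defD det_diag.
have -> : (n - #|[set i | dK 0%R i != 0%R]|)%N = #|[set i | dK 0 i == 0]|.
  have -> : [set i | dK 0 i != 0] = ~: [set i | dK 0 i == 0].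
    by apply/setP=> i; rewrite !inE.
  by rewrite -[RHS](addnK #|~: [set i | dK 0 i == 0]|) cardsC card_ord.
rewrite (bigID (mem [set i | dK 0 i == 0])) /= dvdz_mulr //.
rewrite -sum1_card; elim/big_rec2: _ => [|i y x]; first by rewrite expn0.
rewrite inE !mxE => di0 IH; rewrite add1n expnS PoszM dvdz_mul //.
by rewrite (dvdz_pcharf pK).
Qed.

(** * Multiplication matrices in cyclotomic rings *)

(** Multiplication by h on the quotient of Z[X] by the monic polynomial d of
    degree n, in the basis of the powers of X, acting on row vectors. *)
Definition mulmod_mx (n : nat) (d h : {poly int}) : 'M[int]_n :=
  \matrix_(i, j) (Pdiv.Ring.rmodp ('X^i * h) d)`_j.

(** Evaluation at a root x of d factors through the quotient by d, so the column
    of powers of x is an eigenvector, with eigenvalue h(x). *)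
Lemma mulmod_mx_Vandermonde (K : comNzRingType) (n : nat) (d h : {poly int})
    (x : 'rV[K]_n) :
    d \is monic -> size d = n.+1 ->
    (forall i, root (map_poly intr d) (x 0 i)) ->
  map_mx intr (mulmod_mx n d h) *m Vandermonde n x =
  Vandermonde n x *m diag_mx (\row_i (map_poly intr h).[x 0 i]).
Proof.
move=> d_monic size_d rootd; apply/matrixP=> i j.
rewrite mul_mx_diag !mxE; set r := Pdiv.Ring.rmodp ('X^i * h) d.
have size_r : (size r <= n)%N.
  by rewrite -ltnS -size_d Pdiv.Ring.ltn_rmodpN0 // monic_neq0.
transitivity (map_poly intr r).[x 0 j].
  rewrite (horner_coef_wide _ (leq_trans (size_poly _ _) size_r)).
  by apply: eq_bigr => l _; rewrite !mxE coef_map.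
have := congr1 (fun u => (map_poly intr u).[x 0 j])
  (Pdiv.RingMonic.rdivp_eq d_monic ('X^i * h)).
rewrite rmorphD !rmorphM /= hornerD !hornerM (rootP (rootd j)) mulr0 add0r.
by rewrite map_polyXn hornerXn => ->.
Qed.

Lemma Vandermonde_unitmx (K : fieldType) (n : nat) (x : 'rV[K]_n) :
  injective (x 0) -> Vandermonde n x \in unitmx.
Proof.
move=> injx; rewrite unitmxE unitfE det_Vandermonde.
apply/prodf_neq0 => i _; apply/prodf_neq0 => j ltij.
by rewrite subr_eq0 (inj_eq injx) eq_sym neq_ltn ltij.
Qed.

Definition coprime_residues (k : nat) : seq nat :=
  [seq j <- iota 0 k | coprime k j].

Lemma size_coprime_residues k : size (coprime_residues k) = totient k.
Proof.
by rewrite size_filter -sum1_count totient_count_coprime big_mkcond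
           /index_iota subn0.
Qed.

Lemma mem_coprime_residues k j :
  (j \in coprime_residues k) = (j < k)%N && coprime k j.
Proof. by rewrite mem_filter mem_iota add0n andbC. Qed.

(** In any field, z is a root of X^k - 1 and hence of some Phi_d with d a divisor
    of k.  Then z is also a root of X^d - 1, which forces d = k. *)
Lemma root_Cyclotomic (K : fieldType) (k : nat) (z : K) :
  k.-primitive_root z -> root (map_poly intr 'Phi_k) z.
Proof.
move=> prim_z; have k_gt0 := prim_order_gt0 prim_z.
have := congr1 (map_poly (intr : int -> K)) (prod_Cyclotomic k_gt0).
rewrite rmorph_prod rmorphB /= map_polyXn rmorph1.
move/(congr1 (fun u => root u z)); rewrite [X in _ = X]rootE !hornerE.
rewrite (prim_expr_order prim_z) subrr eqxx /root horner_prod prodf_seq_eq0.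
move=> /hasP[d]; rewrite -dvdn_divisors // => d_dvd_k /= root_d.
have d_gt0 := dvdn_gt0 k_gt0 d_dvd_k.
have k_dvd_d : (k %| d)%N.
  rewrite (prim_order_dvd prim_z) -subr_eq0.
  have := congr1 (map_poly (intr : int -> K)) (prod_Cyclotomic d_gt0).
  rewrite rmorph_prod rmorphB /= map_polyXn rmorph1.
  move/(congr1 (fun u => u.[z])); rewrite horner_prod !hornerE => <-.
  by rewrite prodf_seq_eq0; apply/hasP; exists d; rewrite -?dvdn_divisors.
have/eqP <- : d == k by rewrite eqn_dvd d_dvd_k.
by rewrite /root root_d.
Qed.

Section PrimitiveRoot.
Variables (K : fieldType) (k : nat) (z : K).
Hypothesis prim_z : k.-primitive_root z.

Definition prim_roots : 'rV[K]_(totient k) :=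
  \row_i z ^+ nth 0%N (coprime_residues k) i.

Lemma big_prim_roots (T : Type) (idx : T) (op : Monoid.com_law idx)
    (f : K -> T) :
  \big[op/idx]_(i < totient k) f (prim_roots 0 i) =
  \big[op/idx]_(j <- coprime_residues k) f (z ^+ j).
Proof.
rewrite (big_nth 0%N) size_coprime_residues big_mkord.
by apply: eq_bigr => i _; rewrite mxE.
Qed.

Lemma nth_coprime_residues (i : 'I_(totient k)) :
  nth 0%N (coprime_residues k) i \in coprime_residues k.
Proof. by rewrite mem_nth // size_coprime_residues. Qed.

Lemma prim_roots_inj : injective (prim_roots 0).
Proof.
move=> i j; rewrite !mxE => /eqP; rewrite (eq_prim_root_expr prim_z).
have := nth_coprime_residues i; have := nth_coprime_residues j.
rewrite !mem_coprime_residues => /andP[ltj _] /andP[lti _].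
rewrite !modn_small // nth_uniq ?size_coprime_residues //.
  by move/eqP/val_inj.
by rewrite filter_uniq ?iota_uniq.
Qed.

Variable h : {poly int}.
Let M : 'M[int]_(totient k) := mulmod_mx (totient k) 'Phi_k h.
Let V := Vandermonde (totient k) prim_roots.
Let hK : {poly K} := map_poly intr h.
Let D : 'rV[K]_(totient k) := \row_i hK.[prim_roots 0 i].

Lemma Vandermonde_prim_roots_unitmx : V \in unitmx.
Proof. exact/Vandermonde_unitmx/prim_roots_inj. Qed.

Lemma mulmod_Cyclotomic_diag : map_mx intr M *m V = V *m diag_mx D.
Proof.
apply: mulmod_mx_Vandermonde (Cyclotomic_monic k) (size_Cyclotomic k) _ => i.
have := nth_coprime_residues i; rewrite mxE mem_coprime_residues => /andP[_].
rewrite coprime_sym => co_k; apply: root_Cyclotomic.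
by rewrite prim_root_exp_coprime.
Qed.

(** For K of characteristic zero, this expresses an integer determinant as the
    norm of h(z). *)
Lemma det_mulmod_Cyclotomic :
  (\det M)%:~R = \prod_(j <- coprime_residues k) hK.[z ^+ j].
Proof.
have := congr1 determinant mulmod_Cyclotomic_diag.
rewrite !det_mulmx mulrC det_map_mx /= => /mulrI -> //.
  rewrite det_diag -(big_prim_roots _ (horner hK)).
  by apply: eq_bigr => i _; rewrite mxE.
by rewrite -unitmxE Vandermonde_prim_roots_unitmx.
Qed.

Lemma mxrank_mulmod_Cyclotomic :
  \rank (map_mx (intr : int -> K) M) =
  (totient k - count (fun j => root hK (z ^+ j)) (coprime_residues k))%N.
Proof.
rewrite -(mxrankMfree _ (_ : row_free V))
  ?row_free_unit ?Vandermonde_prim_roots_unitmx //.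
rewrite mulmod_Cyclotomic_diag eqmxMfull ?row_full_unit
  ?Vandermonde_prim_roots_unitmx // mxrank_diag.
have -> : count (fun j => root hK (z ^+ j)) (coprime_residues k) =
          #|[set i | D 0 i == 0]|.
  rewrite -sum1_count -sum1_card big_mkcond [RHS]big_mkcond /=.
  rewrite -(big_prim_roots _ (fun x => if root hK x then 1 else 0)%N).
  by apply: eq_bigr => i _; rewrite inE [D _ _]mxE.
have -> : [set i | D 0%R i != 0%R] = ~: [set i | D 0%R i == 0%R].
  by apply/setP=> i; rewrite !inE.
by rewrite cardsCs setCK card_ord.
Qed.

(** Stands for the fact that the norm of an element of a prime ideal is divisible
    by the norm p ^ f of that ideal; a count of vanishing conjugates replaces the
    residue degree f. *)
Lemma dvdz_det_mulmod_Cyclotomic p (s : seq nat) :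
    p \in [pchar K] -> uniq s -> {subset s <= coprime_residues k} ->
    (forall j, j \in s -> root hK (z ^+ j)) ->
  ((p ^ size s)%N%:Z %| \det M)%Z.
Proof.
move=> pK uniq_s sub_s root_s; apply: dvdz_trans (dvdz_det_corank M pK).
apply/dvdn_exp2l; rewrite mxrank_mulmod_Cyclotomic subKn; last first.
  by rewrite -size_coprime_residues count_size.
rewrite -size_filter uniq_leq_size // => j sj.
by rewrite mem_filter root_s ?sub_s.
Qed.

End PrimitiveRoot.

(** * The mean square of a trinomial at the roots of unity *)

Lemma sum_prim_root_expr (K : fieldType) (k m : nat) (z : K) :
    k.-primitive_root z -> ~~ (k %| m)%N ->
  \sum_(j < k) (z ^+ j) ^+ m = 0.
Proof.
move=> prim_z k_ndvd_m; have := subrX1 (z ^+ m) k.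
rewrite exprAC (prim_expr_order prim_z) expr1n subrr => /esym/eqP.
rewrite mulf_eq0 subr_eq0 -(prim_order_dvd prim_z) (negPf k_ndvd_m) /= => /eqP.
by move=> sum0; rewrite -[RHS]sum0; apply: eq_bigr => j _; rewrite exprAC.
Qed.

Lemma norm_unity_root (C : numClosedFieldType) (k : nat) (z : C) :
  (0 < k)%N -> z ^+ k = 1 -> `|z| = 1.
Proof.
move=> k_gt0 zk1; apply/eqP; rewrite -(pexpr_eq1 k_gt0) ?normr_ge0 //.
by rewrite -normrX zk1 normr1.
Qed.

Lemma conj_unity_root (C : numClosedFieldType) (k : nat) (z : C) :
  (0 < k)%N -> z ^+ k = 1 -> z^* = z^-1.
Proof.
move=> k_gt0 zk1.
by rewrite invC_norm (norm_unity_root k_gt0 zk1) expr1n invr1 mul1r.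
Qed.

Lemma trinomial_mulV (R : comNzRingType) (a a' b b' : R) :
    a * a' = 1 -> b * b' = 1 ->
  (1 + a - b) * (1 + a' - b') = 3 + a + a' - b - b' - a * b' - b * a'.
Proof.
move=> aa1 bb1.
transitivity (1 + a * a' + b * b' + a + a' - b - b' - a * b' - b * a').
  by ring.
by rewrite aa1 bb1; ring.
Qed.

(** Expanding the square by conj u = u^-1 leaves the constant 3 and six
    monomials in u = z ^+ j, whose exponents are nonzero modulo k because 0, r, s
    are distinct; each of them sums to zero over j. *)
Lemma sum_norm_trinomial (C : numClosedFieldType) (k r s : nat) (z : C) :
    k.-primitive_root z -> (0 < r < k)%N -> (0 < s < k)%N -> r != s ->
  \sum_(j < k) `|1 + (z ^+ j) ^+ r - (z ^+ j) ^+ s| ^+ 2 = (3 * k)%:R.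
Proof.
move=> prim_z /andP[r_gt0 ltrk] /andP[s_gt0 ltsk] neq_rs.
have k_gt0 := prim_order_gt0 prim_z.
pose S m := \sum_(j < k) (z ^+ j) ^+ m.
transitivity ((3 * k)%:R + S r + S (k - r)%N - S s - S (k - s)%N
              - S (r + (k - s))%N - S (s + (k - r))%N).
  have -> : (3 * k)%:R = \sum_(j < k) 3 :> C.
    by rewrite sumr_const card_ord mulnC natrM mulr_natl.
  rewrite -!sumrN -!big_split /=; apply: eq_bigr => j _; set u := z ^+ j.
  have uk1 : u ^+ k = 1 by rewrite exprAC (prim_expr_order prim_z) expr1n.
  have conjX m : (m <= k)%N -> (u ^+ m)^* = u ^+ (k - m).
    move=> le_mk; have umk1 : (u ^+ m) ^+ k = 1 by rewrite exprAC uk1 expr1n.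
    rewrite (conj_unity_root k_gt0 umk1).
    have um_neq0 : u ^+ m != 0.
      apply: contra_eq_neq uk1 => um0.
      by rewrite -(subnKC le_mk) exprD um0 mul0r eq_sym oner_eq0.
    by apply: (mulfI um_neq0); rewrite mulfV // -exprD subnKC.
  have inv m : (m <= k)%N -> u ^+ m * u ^+ (k - m) = 1.
    by move=> le_mk; rewrite -exprD subnKC.
  rewrite normCK rmorphB rmorphD rmorph1 /=.
  rewrite (conjX r (ltnW ltrk)) (conjX s (ltnW ltsk)) !exprD.
  exact: trinomial_mulV (inv r (ltnW ltrk)) (inv s (ltnW ltsk)).
have S0 m : ~~ (k %| m)%N -> S m = 0 by exact: sum_prim_root_expr.
have ndvd m : (0 < m < k)%N -> ~~ (k %| m)%N.
  by case/andP=> m_gt0 ltmk; rewrite gtnNdvd.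
have ndvdB a b : (a < k)%N -> (b < k)%N -> (0 < b)%N -> a != b ->
    ~~ (k %| a + (k - b))%N.
  (* The exponent lies strictly between 0 and 2k, so it could only
     be k, which means a = b. *)
  move=> ltak ltbk b_gt0 neq_ab; apply/negP=> /dvdnP[[|[|c]]]; lia.
rewrite (S0 r) ?(S0 s) ?(S0 (k - r)%N) ?(S0 (k - s)%N).
rewrite (S0 (r + (k - s))%N) ?(S0 (s + (k - r))%N); first by ring.
all: by [apply: ndvd; lia | apply: ndvdB; rewrite // eq_sym].
Qed.

(** * Lifting solutions to characteristic zero *)

Lemma expn_inj_ord_mod (k p i j : nat) :
    (1 < k)%N -> coprime k p -> (i < ord_mod k p)%N -> (j < ord_mod k p)%N ->
  p ^ i = p ^ j %[mod k] -> i = j.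
Proof.
rewrite /ord_mod => k_gt1 co_kp; set u := insubd _ _ => lti ltj eq_pij.
have val_u : val u = p%:R by rewrite insubdK // [_ \in _]unitZpE.
have : (u ^+ i == u ^+ j)%g.
  rewrite -val_eqE /= !FinRing.val_unitX val_u -!natrX -val_eqE /=.
  by rewrite !val_Zp_nat // eq_pij.
by rewrite cyclic.eq_expg_mod_order !modn_small // => /eqP.
Qed.

(** The norm N of 1 + z ^+ r - z ^+ s is divisible by p ^ f while N ^ 2 is at
    most ((3 * k) / phi(k)) ^ phi(k), so the size of p forces N = 0 and
    one of the conjugates vanishes.  The bound is stated without division so that
    it is an inequality between natural numbers. *)
Lemma trinomial_lift (K : fieldType) (p k r s : nat) (w : K) :
    p \in [pchar K] -> k.-primitive_root w -> (1 < k)%N -> coprime k p ->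
    (0 < r < k)%N -> (0 < s < k)%N -> r != s ->
    ((3 * k) ^ totient k <
       p ^ (2 * ord_mod k p) * totient k ^ totient k)%N ->
    1 + w ^+ r = w ^+ s ->
  exists2 z : algC, k.-primitive_root z & 1 + z ^+ r = z ^+ s.
Proof.
move=> pK prim_w k_gt1 co_kp hr hs neq_rs large_p eq_w.
have k_gt0 := ltnW k_gt1; have p_gt0 := prime_gt0 (pcharf_prime pK).
have [z prim_z] := C_prim_root_exists k_gt0.
pose h : {poly int} := 1 + 'X^r - 'X^s.
have hE (L : fieldType) (x : L) :
    (map_poly (intr : int -> L) h).[x] = 1 + x ^+ r - x ^+ s.
  by rewrite rmorphB rmorphD rmorph1 /= !map_polyXn !hornerE.
pose N := \det (mulmod_mx (totient k) 'Phi_k h).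
have dvdN : ((p ^ ord_mod k p)%N%:Z %| N)%Z.
  (* The conjugates of w under Frobenius are the powers of w with exponents
     p ^ i mod k; they give ord_mod k p distinct roots of h. *)
  rewrite -(size_iota 0 (ord_mod k p)) -(size_map (fun i => p ^ i %% k)%N).
  apply: (dvdz_det_mulmod_Cyclotomic prim_w pK).
  - rewrite map_inj_in_uniq ?iota_uniq // => i j.
    by rewrite !mem_iota !add0n; apply: expn_inj_ord_mod.
  - move=> _ /mapP[i _ ->]; rewrite mem_coprime_residues ltn_pmod //=.
    by rewrite coprime_modr coprimeXr.
  move=> _ /mapP[i _ ->]; rewrite /root hE.
  have eq_pow t : (w ^+ (p ^ i %% k)) ^+ t = (w ^+ t) ^+ (p ^ i).
    by rewrite (prim_expr_mod prim_w) exprAC.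
  have pnat_pi : [pchar K].-nat (p ^ i)%N.
    by rewrite pnatX (eq_pnat _ (pcharf_eq pK)) pnat_id ?(pcharf_prime pK).
  by rewrite !eq_pow -eq_w exprDn_pchar // expr1n subrr.
have detC := det_mulmod_Cyclotomic prim_z h.
have [N0 | N_neq0] := eqVneq N 0.
  move/eqP: detC; rewrite -/N N0 eq_sym prodf_seq_eq0 => /hasP[j].
  rewrite mem_coprime_residues => /andP[_ co_kj]; rewrite hE subr_eq0 => /eqP.
  by exists (z ^+ j); rewrite // prim_root_exp_coprime // coprime_sym.
pose E i : algC := `|(map_poly intr h).[prim_roots k z 0 i]| ^+ 2.
(* Extending the sum from the j coprime to k to all j < k only adds squares. *)
have sumE : \sum_i E i <= (3 * k)%:R.
  rewrite -(sum_norm_trinomial prim_z hr hs neq_rs).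
  rewrite (big_prim_roots k z _ (fun x : algC => `|(map_poly intr h).[x]| ^+ 2)).
  have iotaE : iota 0 k = index_iota 0 k by rewrite /index_iota subn0.
  rewrite big_filter iotaE big_mkord [X in X <= _]big_mkcond.
  by apply: ler_sum => j _; rewrite hE; case: ifP => // _; rewrite exprn_ge0.
have prodE : \prod_i E i = (`|N| ^ 2)%N%:R.
  rewrite /E prodrXl -normr_prod (big_prim_roots k z _ (horner _)) -detC -/N.
  by rewrite natrX natr_absz intr_norm.
(* leif_AGM_scaled scales each factor by the number of factors, which is where
   totient k ^ totient k comes from. *)
have AGM : (`|N| ^ 2 * totient k ^ totient k <= (3 * k) ^ totient k)%N.
  rewrite -(ler_nat algC) natrM -prodE !natrX.
  have E_ge0 i : 0 <= E i by rewrite exprn_ge0.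
  have [+ _] := leif_AGM_scaled
    (fun i (_ : i \in xpredT) => mulrn_wge0 #|'I_(totient k)| (E_ge0 i)).
  rewrite prodrMn_const card_ord -mulr_natr natrX => /le_trans; apply.
  by rewrite lerXn2r // nnegrE ?ler0n // sumr_ge0.
move: large_p; rewrite ltnNge => /negP[]; apply: leq_trans AGM.
rewrite leq_mul2r mulnC expnM leq_exp2r // orbC.
by rewrite -absz_gt0 in N_neq0; rewrite (dvdn_leq N_neq0).
Qed.

(** * Pairs of roots of unity that differ by one *)

Lemma primitive_cube_root (K : fieldType) (a : K) :
  a ^+ 2 + a + 1 = 0 -> a != 1 -> 3.-primitive_root a.
Proof.
move=> a_eq a_neq1; have a3 : a ^+ 3 = 1.
  apply/eqP; rewrite -subr_eq0; apply/eqP.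
  by transitivity ((a - 1) * (a ^+ 2 + a + 1)); [ring | rewrite a_eq mulr0].
have [m prim_m] := prim_order_exists (isT : 0 < 3)%N a3.
have /primeP[_ /[apply]] := isT : prime 3.
case/orP=> /eqP m_eq; last by rewrite -m_eq.
move: prim_m a_neq1; rewrite m_eq => /prim_expr_order; rewrite expr1 => ->.
by rewrite eqxx.
Qed.

(** Since conjugation inverts a and b, taking norms in 1 + a = b gives
    (1 + a) * (1 + a^-1) = 1, that is a ^+ 2 + a + 1 = 0; so 3 divides k.  Then
    b = - a ^+ 2 has b ^+ k = (-1) ^+ k, so k is even. *)
Lemma unit_triangle (C : numClosedFieldType) (k : nat) (a b : C) :
    (0 < k)%N -> a ^+ k = 1 -> b ^+ k = 1 -> 1 + a = b ->
  (6 %| k)%N /\ a ^+ 3 = 1.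
Proof.
move=> k_gt0 ak1 bk1 eq_b.
have b_eq : b * b^-1 = 1.
  by rewrite mulfV // -normr_eq0 (norm_unity_root k_gt0 bk1) oner_eq0.
have a_eq : a * a^-1 = 1.
  by rewrite mulfV // -normr_eq0 (norm_unity_root k_gt0 ak1) oner_eq0.
have inv_b : b^-1 = 1 + a^-1.
  rewrite -(conj_unity_root k_gt0 bk1) -eq_b rmorphD rmorph1 /=.
  by rewrite (conj_unity_root k_gt0 ak1).
have a_poly : a ^+ 2 + a + 1 = 0.
  transitivity (a * (b * b^-1 - 1)); last by rewrite b_eq subrr mulr0.
  by rewrite inv_b -eq_b; ring: a_eq.
have prim_a : 3.-primitive_root a.
  apply: primitive_cube_root => //; apply: contra_eq_neq a_poly => ->.
  by rewrite expr1n -(natrD _ 1 1) -(natrD _ 2 1) pnatr_eq0.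
split; last exact: prim_expr_order.
rewrite (@Gauss_dvd 2 3) // (prim_order_dvd prim_a) ak1 eqxx andbT.
have b_opp : b = - a ^+ 2.
  by apply/eqP; rewrite -subr_eq0 -eq_b -a_poly; apply/eqP; ring.
move: bk1; rewrite b_opp exprNn exprAC ak1 expr1n mulr1 -signr_odd dvdn2.
case: (odd k) => // /eqP.
by rewrite expr1 eq_sym -subr_eq0 opprK -(natrD _ 1 1) pnatr_eq0.
Qed.

Lemma cube_roots_pair (K : fieldType) (y : K) : 3.-primitive_root y ->
  forall x, (x ^+ 2 + x + 1 == 0) = (x == y) || (x == y ^+ 2).
Proof.
move=> prim_y x; have y3 := prim_expr_order prim_y.
have y_neq1 : y != 1 by rewrite -[y]expr1 -(prim_order_dvd prim_y).
have y_eq : y ^+ 2 + y + 1 = 0.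
  apply: (mulfI (_ : y - 1 != 0)); first by rewrite subr_eq0.
  by transitivity (y ^+ 3 - 1); [ring | rewrite y3 subrr mulr0].
rewrite -(subr_eq0 x y) -(subr_eq0 x (y ^+ 2)) -mulf_eq0.
suff -> : x ^+ 2 + x + 1 = (x - y) * (x - y ^+ 2) by [].
apply/eqP; rewrite -subr_eq0; apply/eqP.
transitivity (x * (y ^+ 2 + y + 1) + (1 - y ^+ 3)); first by ring.
by rewrite y_eq y3 mulr0 subrr addr0.
Qed.

(** From left to right, lift to characteristic zero, where the solution becomes
    a cube root of unity; the relation k %| r * 3 between exponents then descends
    back to K.  Conversely, 1 + x = - x ^+ 2 is a sixth root of unity. *)
Lemma unity_translate (K : fieldType) (p k : nat) (w : K) :
    p \in [pchar K] -> k.-primitive_root w -> (1 < k)%N -> coprime k p ->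
    ((3 * k) ^ totient k <
       p ^ (2 * ord_mod k p) * totient k ^ totient k)%N ->
  forall x : K, [&& x != 1, x ^+ k == 1 & (1 + x) ^+ k == 1] =
                (6 %| k)%N && (x ^+ 2 + x + 1 == 0).
Proof.
move=> pK prim_w k_gt1 co_kp large_p x; have k_gt0 := ltnW k_gt1.
apply/and3P/andP=> [[x_neq1 /eqP xk1 /eqP yk1] | [k6 x_eq]].
  have [[r ltrk] /= x_r] := prim_rootP prim_w xk1.
  have [[s ltsk] /= y_s] := prim_rootP prim_w yk1.
  have r_gt0 : (0 < r)%N.
    by rewrite lt0n; apply: contra_neqN x_neq1 => /eqP r0; rewrite x_r r0.
  have x_neq0 : x != 0.
    by apply: contra_eq_neq xk1 => ->; rewrite expr0n gtn_eqF // eq_sym oner_eq0.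
  have s_gt0 : (0 < s)%N.
    rewrite lt0n; apply: contra_neqN x_neq0 => /eqP s0.
    by apply: (addrI 1); rewrite y_s s0 addr0.
  have neq_rs : r != s.
    apply: contra_neqN (oner_neq0 K) => /eqP eq_rs.
    by apply: (addIr x); rewrite y_s x_r eq_rs add0r.
  have eq_w : 1 + w ^+ r = w ^+ s by rewrite -x_r.
  have [||z prim_z eq_z] :=
    trinomial_lift pK prim_w k_gt1 co_kp _ _ neq_rs large_p eq_w.
  - by rewrite r_gt0.
  - by rewrite s_gt0.
  have unity t : (z ^+ t) ^+ k = 1.
    by rewrite exprAC (prim_expr_order prim_z) expr1n.
  have [k6] := unit_triangle k_gt0 (unity r) (unity s) eq_z.
  rewrite -exprM => /eqP; rewrite -(prim_order_dvd prim_z) => k_dvd.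
  split=> //; apply/eqP/(mulfI (_ : x - 1 != 0)); first by rewrite subr_eq0.
  transitivity (x ^+ 3 - 1); first by ring.
  rewrite mulr0; apply/eqP.
  by rewrite subr_eq0 x_r -exprM -(prim_order_dvd prim_w).
have k3 : (3 %| k)%N := dvdn_trans (isT : 3 %| 6)%N k6.
have prim_y := dvdn_prim_root prim_w k3; set y := w ^+ _ in prim_y.
(* That is, 3 != 0 in K: a field of characteristic 3 has no primitive cube root
   of unity. *)
have root1 : 1 ^+ 2 + 1 + 1 != 0 :> K.
  have pow_neq1 t : (1 == y ^+ t) = (3 %| t)%N.
    by rewrite (prim_order_dvd prim_y) eq_sym.
  by rewrite (cube_roots_pair prim_y) (pow_neq1 1%N) pow_neq1.
have x_neq1 : x != 1 by apply: contraTneq x_eq => ->.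
have prim_x := primitive_cube_root (eqP x_eq) x_neq1.
split=> //; first by rewrite -(prim_order_dvd prim_x).
have y6 : (1 + x) ^+ 6 = 1.
  have -> : 1 + x = - x ^+ 2.
    by apply/eqP; rewrite -subr_eq0 -(eqP x_eq); apply/eqP; ring.
  rewrite exprNn -signr_odd mul1r -exprM; apply/eqP.
  by rewrite -(prim_order_dvd prim_x).
by rewrite -(divnK k6) mulnC exprM y6 expr1n.
Qed.

(** * Counting *)

Lemma mem_cyclotomic_class0 (F : finFieldType) (g : F) (e k : nat) (x : F) :
    k.-primitive_root (g ^+ e) ->
  (x \in cyclotomic_class g e k 0) = (x ^+ k == 1).
Proof.
move=> prim_w; have powE (i : nat) : g ^ (0 + (i * e)%N%:Z) = (g ^+ e) ^+ i.
  by rewrite add0r mulnC -exprM.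
apply/imsetP/eqP=> [[i _ ->] | xk1].
  by rewrite powE exprAC (prim_expr_order prim_w) expr1n.
by have [i ->] := prim_rootP prim_w xk1; exists i; rewrite ?powE.
Qed.

Lemma cyclotomic_number00 (F : finFieldType) (g : F) (e k : nat) :
    k.-primitive_root (g ^+ e) ->
  cyclotomic_number g e k 0 0 =
  #|[set x : F | (x ^+ k == 1) && ((1 + x) ^+ k == 1)]|.
Proof.
move=> prim_w; rewrite -(card_imset _ (_ : injective (fun x => (x, 1 + x)))).
  apply: eq_card => -[x y]; rewrite inE /= !mem_cyclotomic_class0 //.
  apply/and3P/imsetP=> [[xk yk /eqP eq_y] | [t + [-> ->]]].
    by exists x; rewrite ?inE eq_y ?xk ?yk.
  by rewrite inE => /andP[-> ->].
by move=> x y [].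
Qed.

(** Raising the hypothesis to the power 2 * f clears the real exponent. *)
Lemma powR_bound_nat (R : realType) (k p m f : nat) :
    (0 < m)%N -> (0 < f)%N ->
    (3 * k%:R / m%:R : R) `^ (m%:R / (2 * f%:R)) < p%:R ->
  ((3 * k) ^ m < p ^ (2 * f) * m ^ m)%N.
Proof.
move=> m_gt0 f_gt0; set B : R := _ / _ => B_lt.
have B_ge0 : 0 <= B by rewrite divr_ge0 ?mulr_ge0 ?ler0n.
have m_pos : (0 : R) < m%:R by rewrite ltr0n.
have : B ^+ m < p%:R ^+ (2 * f).
  have -> : B ^+ m = (B `^ (m%:R / (2 * f%:R))) ^+ (2 * f).
    rewrite -powR_mulrn // -powR_mulrn ?powR_ge0 // -powRrM natrM divfK //.
    by rewrite mulf_neq0 ?pnatr_eq0 // -lt0n.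
  by rewrite ltrXn2r ?nnegrE ?powR_ge0 ?ler0n // muln_eq0 -lt0n.
rewrite -(ltr_nat R) natrM !natrX natrM expr_div_n ltr_pdivrMr //.
by rewrite exprn_gt0.
Qed.

Theorem theorem5p1 (R : realType) (p n q e k : nat) (F : finFieldType) (g : F)
    (hp : prime p) (hn : (0 < n)%N) (hq : q = (p ^ n)%N)
    (hF : #|F| = q) (hg : (q - 1)%N.-primitive_root g)
    (he : nontrivial_divisor e (q - 1)%N)
    (hk : nontrivial_divisor k (q - 1)%N)
    (hqek : q = (e * k + 1)%N)
    (hbound : (3 * k%:R / (totient k)%:R : R)
                `^ ((totient k)%:R / (2 * (ord_mod k p)%:R)) < p%:R) :
  let N00 := cyclotomic_number g e k 0 0 in
  let two_in_C0 := 2 \in cyclotomic_class g e k 0 in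
  [/\ ~~ (6 %| k)%N -> ~~ two_in_C0 -> N00 = 0%N,
      ~~ (6 %| k)%N -> two_in_C0 -> N00 = 1%N,
      (6 %| k)%N -> ~~ two_in_C0 -> N00 = 2%N
    & (6 %| k)%N -> two_in_C0 -> N00 = 3%N].
Proof.
move=> N00 two_in_C0.
have q_gt1 : (1 < q)%N by rewrite hq -(exp1n n) ltn_exp2r ?prime_gt1.
have [k_dvd k_neq1 _] := hk.
have q1_gt0 : (0 < q - 1)%N by rewrite subn_gt0.
have k_gt0 : (0 < k)%N := dvdn_gt0 q1_gt0 k_dvd.
have k_gt1 : (1 < k)%N by rewrite ltn_neqAle eq_sym k_gt0 andbT; apply/eqP.
have pF : p \in [pchar F] by apply: (@card_finPcharP _ p n); rewrite ?hF.
have prim_w : k.-primitive_root (g ^+ e).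
  have -> : e = ((q - 1) %/ k)%N by rewrite hqek addnK mulnK.
  exact: dvdn_prim_root.
have co_kp : coprime k p.
  apply: coprime_dvdl k_dvd _; rewrite -(coprime_pexpr _ _ hn) -hq subn1.
  by rewrite -{2}(prednK (ltnW q_gt1)) coprimenS.
have large_p := powR_bound_nat _ _ hbound.
have {}large_p : ((3 * k) ^ totient k <
       p ^ (2 * ord_mod k p) * totient k ^ totient k)%N.
  by apply: large_p; rewrite ?totient_gt0 ?order_gt0.
have sols := unity_translate pF prim_w k_gt1 co_kp large_p.
have N00E : N00 = (two_in_C0 + (if (6 %| k)%N then 2 else 0))%N.
  rewrite /N00 /two_in_C0 cyclotomic_number00 // mem_cyclotomic_class0 //.
  (* The term split off at x = 1 is the condition on 2. *)
  rewrite (cardsD1 1) inE expr1n eqxx /=; congr (_ + _)%N.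
  transitivity #|[set x : F | (6 %| k)%N && (x ^+ 2 + x + 1 == 0)]|.
    by apply: eq_card => x; rewrite !inE sols.
  case: ifP => [k6|_]; last by apply: eq_card0 => x; rewrite inE.
  have prim_y := dvdn_prim_root prim_w (dvdn_trans (isT : 3 %| 6)%N k6).
  set y := (_ ^+ (k %/ 3)) in prim_y.
  transitivity #|[set y; y ^+ 2]|.
    by apply: eq_card => x; rewrite !inE (cube_roots_pair prim_y).
  by rewrite cards2 -[X in X != _]expr1 (eq_prim_root_expr prim_y).
by rewrite N00E; split=> [/negPf-> /negPf->|/negPf-> ->|-> /negPf->|-> ->].
Qed.
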